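(* Let $q=p^e$ with $p$ a prime, and suppose $q\equiv 1 \pmod 6$. Let $a,b\in\mathbb{F}_q$ be such that $E_{a,b}: y^2=x^3+ax+b$ is an elliptic curve over $\mathbb{F}_q$, and assume $a\neq 0$ and that $-a/3$ is a nonzero square in $\mathbb{F}_q$ (a quadratic residue). Let $T$ be a generator of the character group $\widehat{\mathbb{F}_q^{\times}}$ and let $k\in\mathbb{F}_q$ satisfy $3k^2+a=0$. Then $$a_q(E_{a,b})=-q\,T^{\frac{q-1}{2}}(-k)\;{}_{2}F_1\left(\begin{array}{cc} T^{\frac{q-1}{6}}, & T^{\frac{5(q-1)}{6}}\\ & \epsilon\end{array}\Big|\, -\frac{k^3+ak+b}{4k^3}\right),$$ where $\epsilon$ is the trivial character.
   Context: Every multiplicative character $\chi$ of $\mathbb{F}_q^{\times}$ (including the trivial character $\epsilon$) is extended to $\mathbb{F}_q$ by $\chi(0):=0$. For characters $A,B$ of $\mathbb{F}_q^{\times}$, define ${A \choose B}:=\frac{B(-1)}{q}\sum_{x\in\mathbb{F}_q}A(x)\overline{B}(1-x)$, where $\overline{B}$ is the inverse character. Greene's Gaussian hypergeometric series is ${}_{2}F_1\left(\begin{array}{cc} A_0, & A_1\\ & B_1\end{array}\Big|\, x\right):=\frac{q}{q-1}\sum_{\chi}{A_0\chi \choose \chi}{A_1\chi \choose B_1\chi}\chi(x)$ for $x\in\mathbb{F}_q$, the sum over all characters $\chi$ of $\mathbb{F}_q^{\times}$. The trace of Frobenius is $a_q(E)=q+1-\#E(\mathbb{F}_q)$, where $\#E(\mathbb{F}_q)$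 counts the $\mathbb{F}_q$-points including the point at infinity. Products and powers of characters are taken pointwise, e.g. $T^{m}(x)=T(x)^m$. *)

(* Defs.v *)
From HB Require Import structures.
From mathcomp Require Import all_boot all_order all_algebra.
From mathcomp Require Import all_fingroup all_solvable all_field all_character.

Set Implicit Arguments.
Unset Strict Implicit.
Unset Printing Implicit Defensive.

Import GRing.Theory Num.Theory.
Local Open Scope ring_scope.

(* Multiplicative characters are the linear characters of the group of units;
   their ring structure in 'CF(_) is pointwise, so that A * B, T ^+ m, B^-1 and
   1 are the product, power, inverse and trivial characters. *)
Notation mchar F := 'CF([set: {unit F}]).

(* [insub] sends a nonzero x to the corresponding unit and 0 to [None]. *)
Definition mchar_ext (F : finFieldType) (chi : mchar F) (x : F) : algC :=
  if insub x is Some u then chi u else 0.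

Definition mchar_generator (F : finFieldType) (T : mchar F) : Prop :=
  T \is a linear_char /\
  forall chi : mchar F, chi \is a linear_char -> exists n : nat, chi = T ^+ n.

Definition mchar_binom (F : finFieldType) (A B : mchar F) : algC :=
  mchar_ext B (- 1) / #|F|%:R *
  \sum_(x : F) mchar_ext A x * mchar_ext B^-1 (1 - x).

Definition greene_2F1 (F : finFieldType) (A0 A1 B1 : mchar F) (x : F) : algC :=
  #|F|%:R / (#|F|%:R - 1) *
  \sum_(i : Iirr [set: {unit F}] | 'chi_i \is a linear_char)
     mchar_binom (A0 * 'chi_i) 'chi_i * mchar_binom (A1 * 'chi_i) (B1 * 'chi_i)
     * mchar_ext 'chi_i x.

Definition short_cubic (R : nzRingType) (a b : R) : {poly R} :=
  'X^3 + a *: 'X + b%:P.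

(* Smoothness of the projective curve y^2 = x^3 + a x + b is tested at its
   affine points over all field extensions; the point at infinity [0 : 1 : 0]
   is smooth in every characteristic. *)
Definition is_elliptic_curve (F : fieldType) (a b : F) : Prop :=
  forall (L : fieldType) (iota : {rmorphism F -> L}) (x y : L),
    let f := short_cubic (iota a) (iota b) in
    y ^+ 2 = f.[x] -> ~ (2 * y = 0 /\ f^`().[x] = 0).

(* The added point is the point at infinity. *)
Definition num_points (F : finFieldType) (a b : F) : nat :=
  #|[set P : F * F | P.2 ^+ 2 == (short_cubic a b).[P.1]]|.+1.

Definition frobenius_trace (F : finFieldType) (a b : F) : int :=
  #|F|%:Z + 1 - (num_points a b)%:Z.

(* Main.v *)
Require Import Defs.
From mathcomp Require Import all_boot all_order all_algebra.
From mathcomp Require Import all_fingroup all_solvable all_field all_character.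
From mathcomp Require Import ring.

Set Implicit Arguments.
Unset Strict Implicit.
Unset Printing Implicit Defensive.

Import Order.TTheory GRing.Theory Num.Theory.
Local Open Scope ring_scope.

(* Translating x by k turns the cubic into k^3 (27 t^2 (1 - t) - 4 l), where l
   is the argument of the hypergeometric series. Expanding phi(1 - y) over all
   characters makes the trace a Fourier series in l, so that the theorem becomes
   an identity between Jacobi sums for each character chi. In terms of Gauss
   sums that identity is the combination of the Hasse-Davenport product formulas
   for 2 and for 3.

   The formula for 2 comes from a substitution in a Jacobi sum; the formula for 3
   from the case of equality in the triangle inequality. The norms of
     chi(-27) g(chi) g(chi w) g(chi w^-1) g(chi^-3)
   are known, and the sum of these numbers over chi, which is q (q - 1) times the
   sum of w(y/z) over the nodal cubic 27 xyz = 1, x + y + z = 1, equals the sum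
   of their norms. *)

(** * Multiplicative characters *)

Local Notation ext := mchar_ext.
Local Notation "''q_' F" := (#|F|%:R : algC) (at level 8, F at level 2).

Lemma unit_abelian (F : finFieldType) : abelian [set: {unit F}].
Proof. by apply/centsP=> u _ v _; apply: val_inj; rewrite /= mulrC. Qed.

Lemma irr_unit_lin (F : finFieldType) (i : Iirr [set: {unit F}]) :
  'chi_i \is a linear_char.
Proof. exact: (char_abelianP _ (unit_abelian F)). Qed.

Lemma ext0 (F : finFieldType) (A : mchar F) : ext A 0 = 0.
Proof. by rewrite /mchar_ext insubF // unitr0. Qed.

Lemma ext_val (F : finFieldType) (A : mchar F) (u : {unit F}) :
  ext A (val u) = A u.
Proof. by rewrite /mchar_ext valK. Qed.

Lemma neq0_unit (F : finFieldType) (x : F) :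
  x != 0 -> exists u : {unit F}, x = val u.
Proof.
move=> x0; have xU : x \is a GRing.unit by rewrite unitfE.
by exists (FinRing.unit F xU).
Qed.

Lemma ext1x (F : finFieldType) (x : F) : ext (1 : mchar F) x = (x != 0)%:R.
Proof.
have [->|/neq0_unit[u ->]] := eqVneq x 0; first by rewrite ext0.
by rewrite ext_val cfun1E inE.
Qed.

Lemma ext_mull (F : finFieldType) (A B : mchar F) x :
  ext (A * B) x = ext A x * ext B x.
Proof.
have [->|/neq0_unit[u ->]] := eqVneq x 0; first by rewrite !ext0 mulr0.
by rewrite !ext_val cfunE.
Qed.

Lemma ext_inv (F : finFieldType) (A : mchar F) x :
  A \is a linear_char -> ext A^-1 x = (ext A x)^-1.
Proof.
move=> Al; have [->|/neq0_unit[u ->]] := eqVneq x 0.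
  by rewrite !ext0 invr0.
rewrite !ext_val invr_lin_char // cfunE -lin_charV ?inE //.
by rewrite lin_charV_conj ?inE.
Qed.

Lemma lin_mul (F : finFieldType) (A B : mchar F) :
  A \is a linear_char -> B \is a linear_char -> A * B \is a linear_char.
Proof. exact: rpredM. Qed.

Lemma lin_inv (F : finFieldType) (A : mchar F) :
  A \is a linear_char -> A^-1 \is a linear_char.
Proof. by move=> Al; rewrite rpredV. Qed.

Lemma extM (F : finFieldType) (A : mchar F) x y :
  A \is a linear_char -> ext A (x * y) = ext A x * ext A y.
Proof.
move=> Al; have [->|/neq0_unit[u ->]] := eqVneq x 0.
  by rewrite mul0r !ext0 mul0r.
have [->|/neq0_unit[v ->]] := eqVneq y 0.
  by rewrite mulr0 !ext0 mulr0.
have -> : val u * val v = val (u * v)%g by [].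
by rewrite !ext_val lin_charM ?inE.
Qed.

Lemma ext1 (F : finFieldType) (A : mchar F) :
  A \is a linear_char -> ext A 1 = 1.
Proof.
move=> Al; have -> : 1 = val (1%g : {unit F}) by [].
by rewrite ext_val lin_char1.
Qed.

Lemma norm_ext (F : finFieldType) (A : mchar F) x :
  A \is a linear_char -> x != 0 -> `|ext A x| = 1.
Proof. by move=> Al /neq0_unit[u ->]; rewrite ext_val normC_lin_char ?inE. Qed.

Lemma ext_neq0 (F : finFieldType) (A : mchar F) x :
  A \is a linear_char -> x != 0 -> ext A x != 0.
Proof. by move=> Al x0; rewrite -normr_gt0 norm_ext. Qed.

Lemma extX (F : finFieldType) (A : mchar F) x n :
  A \is a linear_char -> ext A (x ^+ n) = ext A x ^+ n.
Proof.
by move=> Al; elim: n => [|n IH]; rewrite ?expr0 ?ext1 // !exprS extM // IH.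
Qed.

Lemma extV (F : finFieldType) (A : mchar F) x :
  A \is a linear_char -> ext A x^-1 = (ext A x)^-1.
Proof.
move=> Al; have [->|x0] := eqVneq x 0; first by rewrite invr0 ext0 invr0.
by apply: (mulIf (ext_neq0 Al x0)); rewrite -extM // !mulVf ?ext1 ?ext_neq0.
Qed.

Lemma mchar_neq1 (F : finFieldType) (A : mchar F) : A != 1 ->
  exists2 x : F, x != 0 & ext A x != 1.
Proof.
move=> An1; have [u Au] : exists u, A u != 1.
  apply/existsP; apply: contraNT An1; rewrite negb_exists => /forallP Au.
  by apply/eqP/cfunP=> u; rewrite cfun1E inE; apply/eqP; rewrite -[_ == _]negbK.
exists (val u); last by rewrite ext_val.
by rewrite -unitfE (valP u).
Qed.

Lemma sum_delta (R : pzRingType) (I : finType) (i : I) (f : I -> R) :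
  \sum_j (j == i)%:R * f j = f i.
Proof.
rewrite (bigD1 i) //= eqxx mul1r big1 ?addr0 // => j /negPf->.
by rewrite mul0r.
Qed.

(** Scaling the variable by [u] multiplies the sum by [ext A u], so a single [u] with [ext A u != 1]
    forces it to vanish. *)
Lemma sum_ext (F : finFieldType) (A : mchar F) : A \is a linear_char ->
  \sum_(x : F) ext A x = (A == 1)%:R * ('q_F - 1).
Proof.
move=> Al; have [->|/mchar_neq1[u u0 Au]] := eqVneq A 1.
  rewrite mul1r -[#|F|%:R]sumr_const.
  rewrite -[X in _ - X](sum_delta (0 : F) (fun=> 1)) -sumrB.
  apply: eq_bigr => x _.
  by rewrite ext1x; case: eqP => _; rewrite ?mul1r ?subrr // mul0r subr0.
rewrite mul0r; apply/eqP; have : (1 - ext A u) * \sum_x ext A x = 0.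
  rewrite mulrBl mul1r mulr_sumr [X in X - _](reindex_inj (mulfI u0)) /=.
  by apply/eqP; rewrite subr_eq0; apply/eqP/eq_bigr => x _; rewrite extM.
by move/eqP; rewrite mulf_eq0 subr_eq0 eq_sym (negPf Au).
Qed.

(** The decomposition of the regular character, evaluated at a unit; all degrees are 1 because the
    group is abelian. *)
Lemma sum_irr (F : finFieldType) (x : F) :
  \sum_(i : Iirr [set: {unit F}]) ext 'chi_i x = (x == 1)%:R * ('q_F - 1).
Proof.
have [->|/neq0_unit[u ->]] := eqVneq x 0.
  by rewrite eq_sym oner_eq0 mul0r big1 // => i _; rewrite ext0.
have /cfunP/(_ u) := cfReg_sum [group of [set: {unit F}]].
rewrite cfRegE sum_cfunE card_finField_unit => eqS.
transitivity (#|F|.-1%:R *+ (u == 1%g) : algC).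
  rewrite eqS; apply: eq_bigr => i _.
  by rewrite cfunE lin_char1 ?irr_unit_lin // mul1r ext_val.
rewrite mulrC mulr_natr -subn1 natrB //.
have F0 : (0 < #|F|)%N by apply/card_gt0P; exists 0.
exact: F0.
Qed.

(** * Gauss and Jacobi sums *)

(* Any nontrivial additive character would do; the default value 0 of [odflt] is
   never reached. *)
Definition additive_char (F : finFieldType) (x : F) : algC :=
  'chi[[set: F]]_(odflt 0 [pick i | i != 0]) x.

Lemma additive_char_lin (F : finFieldType) (i : Iirr [set: F]) :
  'chi_i \is a linear_char.
Proof.
apply: (char_abelianP _ _).
by apply/centsP=> x _ y _; rewrite /commute !FinRing.zmodMgE addrC.
Qed.

Lemma additive_charD (F : finFieldType) (x y : F) :
  additive_char (x + y) = additive_char x * additive_char y.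
Proof.
by rewrite -FinRing.zmodMgE /additive_char lin_charM ?additive_char_lin ?inE.
Qed.

Lemma additive_char0 (F : finFieldType) : additive_char (0 : F) = 1.
Proof.
by rewrite -FinRing.zmod1gE /additive_char lin_char1 ?additive_char_lin.
Qed.

Lemma additive_charN (F : finFieldType) (x : F) :
  additive_char (- x) = (additive_char x)^*.
Proof.
rewrite -FinRing.zmodVgE /additive_char.
by rewrite lin_charV_conj ?additive_char_lin ?inE.
Qed.

Lemma additive_char_neq1 (F : finFieldType) :
  exists x : F, additive_char x != 1.
Proof.
rewrite /additive_char; case: pickP => [i /= i0 | all0] /=.
  apply/existsP; apply: contraNT i0; rewrite negb_exists => /forallP chi1.
  rewrite -irr_eq1; apply/eqP/cfunP=> x; rewrite cfun1E inE.
  by apply/eqP; rewrite -[_ == _]negbK.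
(* Were 0 the only index, [F] would have one irreducible character, whereas an abelian group has as
   many as it has elements. *)
have : abelian [set: F].
  by apply/centsP=> x _ y _; rewrite /commute !FinRing.zmodMgE addrC.
rewrite card_classes_abelian -NirrE cardsT => /eqP card_Iirr.
have : (1 < #|F|)%N by apply: finNzRing_gt1.
rewrite -card_Iirr -{1}(card_ord (Nirr _)) => /card_gt1P[i [j [_ _]]].
by move: (all0 i) (all0 j) => /negbFE/eqP-> /negbFE/eqP->; rewrite eqxx.
Qed.

Lemma sum_additive_char (F : finFieldType) (c : F) :
  \sum_x additive_char (c * x) = (c == 0)%:R * 'q_F.
Proof.
have [->|c0] := eqVneq c 0.
  rewrite mul1r -[#|F|%:R]sumr_const; apply: eq_bigr => x _.
  by rewrite mul0r additive_char0.
transitivity (\sum_(x : F) additive_char x).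
  by rewrite [RHS](reindex_inj (mulfI c0)).
rewrite mul0r.
have [a a1] := additive_char_neq1 F.
apply/eqP; have : (1 - additive_char a) * \sum_(x : F) additive_char x = 0.
  rewrite mulrBl mul1r mulr_sumr [X in X - _](reindex_inj (addrI a)) /=.
  by apply/eqP; rewrite subr_eq0; apply/eqP/eq_bigr => x _; rewrite additive_charD.
by move/eqP; rewrite mulf_eq0 subr_eq0 eq_sym (negPf a1).
Qed.

Definition gauss (F : finFieldType) (A : mchar F) : algC :=
  \sum_x ext A x * additive_char x.

Definition jacobi (F : finFieldType) (A B : mchar F) : algC :=
  \sum_x ext A x * ext B (1 - x).

Lemma gauss_scale (F : finFieldType) (A : mchar F) (w : F) :
  A \is a linear_char -> w != 0 ->
  gauss A = ext A (- w) * \sum_x ext A x * additive_char (- w * x).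
Proof.
move=> Al w0; have Nw0 : - w != 0 by rewrite oppr_eq0.
rewrite /gauss (reindex_inj (mulfI Nw0)) mulr_sumr; apply: eq_bigr => x _ /=.
by rewrite extM // mulrA.
Qed.

(* [P] stands for a product of Gauss sums, in which all variables have been
   scaled by [- w] with [w] the variable of the remaining Gauss sum. *)
Lemma gauss_homog (F : finFieldType) (C : mchar F) (I : finType) (P : algC)
    (c : I -> algC) (s : I -> F) : C \is a linear_char ->
  (forall w, w != 0 ->
     P = ext C (- w) * \sum_t c t * additive_char (- w * s t)) ->
  P * gauss C^-1 = ext C (- 1) * \sum_t c t * ((s t == 1)%:R * 'q_F - 1).
Proof.
move=> Cl P_scale.
(* The factor [1 - (w == 0)%:R] records that characters vanish at 0. The sum over [w] is then a
   complete additive character sum, ['q_F] or 0, minus its term 1 at [w = 0]. *)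
transitivity (\sum_w (1 - (w == 0)%:R) * (ext C (- 1) *
    \sum_t c t * additive_char ((1 - s t) * w))).
  rewrite /gauss mulr_sumr; apply: eq_bigr => w _; rewrite ext_inv //.
  have [->|w0] := eqVneq w 0.
    by rewrite ext0 invr0 mul0r mulr0 subrr mul0r.
  rewrite subr0 mul1r (P_scale w w0) -(mulN1r w) extM //.
  set S := \sum_t _.
  have -> : ext C (- 1) * ext C w * S * ((ext C w)^-1 * additive_char w)
      = ext C (- 1) * (S * additive_char w) * (ext C w / ext C w) by ring.
  rewrite divff ?ext_neq0 //; rewrite mulr1 mulr_suml; congr (_ * _).
  apply: eq_bigr => t _; rewrite -mulrA -additive_charD; congr (_ * additive_char _).
  by ring.
under eq_bigr do rewrite mulrCA mulr_sumr.
rewrite -mulr_sumr exchange_big /=; congr (_ * _); apply: eq_bigr => t _.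
under eq_bigr do rewrite mulrCA.
rewrite -mulr_sumr; congr (_ * _); under eq_bigr do rewrite mulrBl mul1r.
by rewrite sumrB sum_delta mulr0 additive_char0 sum_additive_char subr_eq0 eq_sym.
Qed.

Lemma ext_sqrN1 (F : finFieldType) (A : mchar F) :
  A \is a linear_char -> ext A (- 1) * ext A (- 1) = 1.
Proof. by move=> Al; rewrite -extM // mulrNN mulr1 ext1. Qed.

(** The one-variable case of [gauss_homog]: the indicator selects [x = 1], and the constant [-1]
    leaves the complete sum of [A]. *)
Lemma gauss_inv (F : finFieldType) (A : mchar F) : A \is a linear_char ->
  gauss A * gauss A^-1 = ext A (- 1) * ('q_F - (A == 1)%:R * ('q_F - 1)).
Proof.
move=> Al; rewrite (gauss_homog Al (fun w w0 => gauss_scale Al w0)).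
rewrite -sum_ext //; congr (_ * _).
transitivity (\sum_x ((x == 1)%:R * (ext A x * 'q_F) - ext A x)).
  by apply: eq_bigr => x _; ring.
by rewrite sumrB sum_delta ext1 // mul1r.
Qed.

(** The two-variable case of [gauss_homog]: the line [x + y = 1] carries the Jacobi sum, and the
    constant [-1] leaves the product of the sums of [A] and [B], which is 0 unless both are trivial.
    Multiplying by [gauss (A * B)^-1], instead of dividing by [gauss (A * B)], keeps the formula
    valid when [A * B = 1]. *)
Lemma gauss_jacobi (F : finFieldType) (A B : mchar F) :
  A \is a linear_char -> B \is a linear_char -> (A != 1) || (B != 1) ->
  gauss A * gauss B * gauss (A * B)^-1 =
  ext A (- 1) * ext B (- 1) * 'q_F * jacobi A B.
Proof.
move=> Al Bl AB1; have ABl := lin_mul Al Bl.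
rewrite (@gauss_homog _ _ (F * F)%type _ (fun t => ext A t.1 * ext B t.2)
   (fun t => t.1 + t.2)) //.
  rewrite -(pair_bigA _ (fun x y => ext A x * ext B y *
     ((x + y == 1)%:R * 'q_F - 1))) /= ext_mull -!mulrA.
  do 2 congr (_ * _); rewrite /jacobi mulr_sumr.
  transitivity (\sum_x \sum_y (y == 1 - x)%:R * ('q_F * ext A x * ext B y)
      - (\sum_x ext A x) * \sum_y ext B y).
    rewrite mulr_suml -sumrB; apply: eq_bigr => x _.
    rewrite mulr_sumr -sumrB; apply: eq_bigr => y _.
    by rewrite (eq_sym y) subr_eq (addrC y) eq_sym; ring.
  rewrite !sum_ext //.
  have -> : (A == 1)%:R * ('q_F - 1) * ((B == 1)%:R * ('q_F - 1)) = 0.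
    by case/orP: AB1 => /negPf->; rewrite ?mul0r ?mulr0 ?mul0r ?mulr0.
  rewrite subr0; apply: eq_bigr => x _.
  by rewrite sum_delta mulrA.
move=> w w0; rewrite (gauss_scale Al w0) (gauss_scale Bl w0) ext_mull.
rewrite -(pair_bigA _ (fun x y => ext A x * ext B y *
     additive_char (- w * (x + y)))) /= mulrACA mulr_suml; congr (_ * _).
apply: eq_bigr => x _; rewrite mulr_sumr; apply: eq_bigr => y _.
by rewrite mulrDr additive_charD; ring.
Qed.

Lemma conj_gauss (F : finFieldType) (A : mchar F) : A \is a linear_char ->
  (gauss A)^* = ext A (- 1) * gauss A^-1.
Proof.
move=> Al; rewrite /gauss rmorph_sum mulr_sumr (reindex_inj oppr_inj) /=.
apply: eq_bigr => x _; rewrite rmorphM /= -additive_charN opprK mulrA; congr (_ * _).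
have [->|x0] := eqVneq x 0; first by rewrite oppr0 !ext0 rmorph0 mulr0.
rewrite -(mulN1r x) extM // ext_inv // rmorphM /=.
have conjE y : y != 0 -> (ext A y)^* = (ext A y)^-1.
  move=> y0; apply: (mulIf (ext_neq0 Al y0)); rewrite mulVf ?ext_neq0 //.
  by rewrite mulrC -normCK norm_ext // expr1n.
have N0 : (-1 : F) != 0 by rewrite oppr_eq0 oner_eq0.
rewrite !conjE //; congr (_ * _).
by apply: (mulIf (ext_neq0 Al N0)); rewrite mulVf ?ext_neq0 // ext_sqrN1.
Qed.

Lemma normsq_gauss (F : finFieldType) (A : mchar F) : A \is a linear_char ->
  `|gauss A| ^+ 2 = if A == 1 then 1 else 'q_F.
Proof.
move=> Al; rewrite normCK conj_gauss // mulrCA gauss_inv // mulrA ext_sqrN1 //.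
by case: eqP => _ /=; ring.
Qed.

Lemma gauss_neq0 (F : finFieldType) (A : mchar F) :
  A \is a linear_char -> gauss A != 0.
Proof.
move=> Al; have : `|gauss A| ^+ 2 != 0.
  rewrite normsq_gauss //; case: ifP => _; first exact: oner_neq0.
  by rewrite pnatr_eq0 -lt0n; apply/card_gt0P; exists 0.
by rewrite expf_eq0 /= normr_eq0.
Qed.

(** * The triplication formula *)

Lemma sum_triple (R : nmodType) (I : finType) (G : I * I * I -> R) :
  \sum_t G t = \sum_x \sum_y \sum_z G (x, y, z).
Proof. by rewrite !pair_bigA; apply: eq_bigr => -[[x y] z]. Qed.

(* The node is (1/3, 1/3, 1/3); the smooth points are parametrized by
   y = - s^2 / (3 (s + 1)) and z = - 1 / (3 s (s + 1)), so that y / z = s^3. *)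
Lemma nodal_cubic_sum (F : finFieldType) (w : mchar F) :
  w \is a linear_char -> w ^+ 3 = 1 -> (3 : F) != 0 ->
  \sum_y \sum_z (27 * (1 - y - z) * y * z == 1)%:R * (ext w y / ext w z) =
  'q_F - 1 - \sum_(s : F) (s ^+ 2 + s + 1 == 0)%:R.
Proof.
move=> wl w3 n3.
have w_cube (x : F) : x != 0 -> ext w (x ^+ 3) = 1.
  move=> x0; rewrite extX // !exprS expr0 mulr1 -!ext_mull.
  by have -> : w * (w * w) = w ^+ 3 by []; rewrite w3 ext1x x0.
pose P (t : F * F) := 27 * (1 - t.1 - t.2) * t.1 * t.2 == 1.
transitivity (\sum_(t | P t) ext w (t.1 / t.2)).
  rewrite pair_bigA /= [RHS]big_mkcond /=; apply: eq_bigr => t _.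
  rewrite /P; case: ifP => _; first by rewrite mul1r extM // extV.
  by rewrite mul0r.
(* [Q] excludes the poles 0 and -1 of [h] and the parameters that [h] sends to the node. The inverse
   [h'] is the slope [(y - 1/3) / (z - 1/3)] of the line joining a point to the node. *)
pose Q (s : F) := [&& s != 0, s + 1 != 0 & s ^+ 2 + s + 1 != 0].
pose h (s : F) := (- s ^+ 2 / (3 * (s + 1)), - (3 * s * (s + 1))^-1).
pose h' (t : F * F) := (1 - 3 * t.1) / (1 - 3 * t.2).
have Pc : P (3^-1, 3^-1) by rewrite /P /=; apply/eqP; field.
rewrite (bigD1 _ Pc) /= divff ?invr_eq0 // ext1 //.
have Pgeo y z : P (y, z) -> (y, z) != (3^-1, 3^-1) ->
   [/\ 1 - 3 * y != 0, 1 - 3 * z != 0 & 2 - 3 * y - 3 * z != 0].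
  rewrite /P /= xpair_eqE => /eqP Pyz nyz.
  (* Each of the lines [x = 1/3], [y = 1/3], [z = 1/3] meets the cubic only at the node: with
     [u = 1/3] the equation becomes [(1 - 3 * v) ^+ 2 = 0]. *)
  have three (u v : F) : 27 * (1 - u - v) * u * v = 1 -> 1 - 3 * u = 0 ->
      (u == 3^-1) && (v == 3^-1).
    move=> Puv /eqP; rewrite subr_eq0 => /eqP u3.
    have u3' : u = 3^-1 by apply: (mulfI n3); rewrite -u3 divff.
    have : (1 - 3 * v) ^+ 2 = 0.
      transitivity (1 - 27 * (1 - u - v) * u * v); last by rewrite Puv subrr.
      by rewrite u3'; field.
    move=> /eqP; rewrite expf_eq0 /= subr_eq0 => /eqP v3.
    by rewrite u3' eqxx; apply/eqP/(mulfI n3); rewrite -v3 divff.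
  split.
  - by apply: contraNneq nyz => /(three _ _ Pyz).
  - apply: contraNneq nyz => z3; rewrite andbC; apply: (three _ _ _ z3).
    by rewrite -[RHS]Pyz; ring.
  - apply: contraNneq nyz => yz.
    have z2 : 3 * z = 2 - 3 * y.
      by apply/eqP; rewrite -subr_eq0; apply/eqP; rewrite -[RHS]oppr0 -yz; ring.
    apply: (three _ _ Pyz); apply/eqP; rewrite -[_ == 0](expf_eq0 _ 2); apply/eqP.
    transitivity (1 - 3 * y * (3 * z)); first by rewrite z2; ring.
    transitivity (1 - 27 * (1 - y - z) * y * z); last by rewrite Pyz subrr.
    transitivity (1 - 3 * y * (3 * z) * (3 - 3 * y - 3 * z)); last by ring.
    by rewrite z2; ring.
rewrite (reindex_onto h h') /=; last first.
  move=> [y z] /andP[Pyz nyz]; have [y0 z0 yz0] := Pgeo _ _ Pyz nyz.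
  have s1 : h' (y, z) + 1 != 0.
    have -> : h' (y, z) + 1 = (2 - 3 * y - 3 * z) / (1 - 3 * z).
      by rewrite /h' /=; field.
    by rewrite mulf_neq0 ?invr_eq0.
  move: Pyz; rewrite /P /= => /eqP Pyz.
  have cub : 27 * y * z * (1 - y - z) - 1 = 0.
    by apply/eqP; rewrite subr_eq0 -[X in _ == X]Pyz; apply/eqP; ring.
  (* Cleared of denominators by [key], each coordinate of [h (h' (y, z)) = (y, z)] is exactly the
     equation [cub]. *)
  have key (a b c : F) : b != 0 -> a - c * b = 0 -> a / b = c.
    move=> b0 /eqP; rewrite subr_eq0 => /eqP->.
    by rewrite mulfK.
  rewrite /h /h' /= in s1 *; congr (_, _).
    have -> : - ((1 - 3 * y) / (1 - 3 * z)) ^+ 2 /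
       (3 * ((1 - 3 * y) / (1 - 3 * z) + 1)) =
       - (1 - 3 * y) ^+ 2 / (3 * (1 - 3 * z) * (2 - 3 * y - 3 * z)).
      by field; rewrite n3 z0 yz0.
    apply: key; first by rewrite !mulf_neq0.
    by rewrite -cub; ring.
  have -> : - (3 * ((1 - 3 * y) / (1 - 3 * z)) *
       ((1 - 3 * y) / (1 - 3 * z) + 1))^-1 =
       - (1 - 3 * z) ^+ 2 / (3 * (1 - 3 * y) * (2 - 3 * y - 3 * z)).
    by field; rewrite ?n3 ?z0 ?yz0 ?y0.
  apply: key; first by rewrite !mulf_neq0.
  by rewrite -cub; ring.
have hQ s : P (h s) && (h s != (3^-1, 3^-1)) && (h' (h s) == s) = Q s.
  apply/idP/idP.
    move=> /andP[/andP[Phs nhs] _]; rewrite /Q.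
    have s0 : s != 0.
      apply: contraTneq Phs => ->; rewrite /P /h /=.
      have -> : (3 * 0 * (0 + 1))^-1 = 0 :> F by rewrite mulr0 mul0r invr0.
      by rewrite oppr0 mulr0 eq_sym oner_eq0.
    have s1 : s + 1 != 0.
      apply: contraTneq Phs => s1; rewrite /P /h /=.
      have -> : (3 * s * (s + 1))^-1 = 0 by rewrite s1 mulr0 invr0.
      by rewrite oppr0 mulr0 eq_sym oner_eq0.
    rewrite s0 s1 /=; apply: contraNneq nhs => s2.
    (* At a root of [s ^+ 2 + s + 1] these two relations turn both coordinates of [h s] into
       [1/3]. *)
    have ss : s * (s + 1) = -1 by apply/eqP; rewrite -addr_eq0 -s2; apply/eqP; ring.
    have ss' : s + 1 = - s ^+ 2 by apply/eqP; rewrite -subr_eq0 -s2; apply/eqP; ring.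
    rewrite /h -mulrA ss ss'; apply/eqP; congr (_, _); field;
      by rewrite ?oppr_eq0 ?expf_eq0 ?n3 ?s0.
  move=> /and3P[s0 s1 s2].
  have hne : h s != (3^-1, 3^-1).
    apply: contraNneq s2 => -[_ hs]; move: hs.
    rewrite -invrN => /invr_inj hs; apply/eqP/(mulfI n3).
    have -> : 3 * (s ^+ 2 + s + 1) = 3 - - (3 * s * (s + 1)) by ring.
    by rewrite hs subrr mulr0.
  have Phs : P (h s) by rewrite /P /h /=; apply/eqP; field; rewrite n3 s0 s1.
  rewrite Phs hne /= /h' /h /=; apply/eqP; field.
  rewrite ?n3 ?s0 ?s1 /=.
  by have -> : s * (s + 1) + 1 = s ^+ 2 + s + 1 by ring.
rewrite (eq_bigl Q) //.
transitivity (1 + \sum_(s | Q s) (1 : algC)).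
  congr (_ + _); apply: eq_bigr => s /and3P[s0 s1 _]; rewrite -(w_cube s s0).
  congr (ext w _); field.
  by rewrite ?oppr_eq0 ?oner_eq0 n3 s0 s1.
rewrite big_mkcond /=.
(* The three excluded sets are disjoint, so their indicators subtract; the final [+ 1] is the
   node. *)
transitivity (\sum_(s : F) ((1 : algC) - (s == 0)%:R * 1 - (s == -1)%:R * 1
   - (s ^+ 2 + s + 1 == 0)%:R) + 1).
  rewrite addrC; congr (_ + _); apply: eq_bigr => s _; rewrite /Q addr_eq0.
  have [->|s0] := eqVneq s 0.
    by rewrite expr0n /= !add0r oner_eq0 eq_sym oppr_eq0 oner_eq0 /=; ring.
  have [->|s1] := eqVneq s (-1).
    by rewrite sqrrN expr1n subrr add0r oner_eq0 /=; ring.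
  by case: eqP => _ /=; ring.
by rewrite !sumrB !sum_delta sumr_const; ring.
Qed.

(** As [3 != 0], 1 is not a root of the quadratic factor of [x ^+ 3 - 1]. This links the parameters
    of the node to the number of characters of trivial cube. *)
Lemma card_cube_roots1 (F : finFieldType) : (3 : F) != 0 ->
  \sum_(x : F) (x ^+ 3 == 1)%:R =
  1 + \sum_(x : F) (x ^+ 2 + x + 1 == 0)%:R :> algC.
Proof.
move=> n3; rewrite -[X in X + _](sum_delta (1 : F) (fun=> 1)) -big_split /=.
apply: eq_bigr => x _; rewrite mulr1.
have -> : (x ^+ 3 == 1) = (x == 1) || (x ^+ 2 + x + 1 == 0).
  rewrite -subr_eq0 -[x == 1]subr_eq0 -mulf_eq0; congr (_ == 0); ring.
have [->|_] := eqVneq x 1; last by rewrite add0r.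
have -> : 1 ^+ 2 + 1 + 1 = 3 :> F by ring.
by rewrite (negPf n3) addr0.
Qed.

Lemma lin_exp (F : finFieldType) (A : mchar F) n :
  A \is a linear_char -> A ^+ n \is a linear_char.
Proof. by move=> Al; rewrite rpredX. Qed.

Lemma ext_exp (F : finFieldType) (A : mchar F) n x :
  x != 0 -> ext (A ^+ n) x = ext A x ^+ n.
Proof.
move=> x0; elim: n => [|n IH]; first by rewrite !expr0 ext1x x0.
by rewrite !exprS ext_mull IH.
Qed.

Lemma lin_irr_ex (F : finFieldType) (A : mchar F) :
  A \is a linear_char -> exists i, A = 'chi_i.
Proof. by move=> /lin_char_irr/irrP. Qed.

Lemma qF_neq0 (F : finFieldType) : 'q_F != 0.
Proof. by rewrite pnatr_eq0 -lt0n; apply/card_gt0P; exists 0. Qed.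

Section Triplication.

Variables (F : finFieldType) (w : mchar F).
Hypotheses (w_lin : w \is a linear_char) (w_neq1 : w != 1).
Hypothesis w_cube : w ^+ 3 = 1.
(** The alternatives tell which of the three Gauss sums in [prod3 A] is that of the trivial
    character. *)
Hypothesis cube_eq1 : forall A : mchar F, A \is a linear_char -> A ^+ 3 = 1 ->
  [\/ A = 1, A * w = 1 | A * w^-1 = 1].
Hypothesis F3 : (3 : F) != 0.

Let prod3 (A : mchar F) := gauss A * gauss (A * w) * gauss (A * w^-1).

(** The three-variable case of [gauss_homog], with [C = A ^+ 3]. In the factor at [- 27], the sign
    cancels [ext (A ^+ 3) (- 1)], and 27 is chosen so that summing over [A] will impose
    [27 * x * y * z = 1]. *)
Lemma prod3_expand (A : mchar F) : A \is a linear_char ->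
  ext A (- 27) * (prod3 A * gauss (A ^+ 3)^-1) =
  \sum_x \sum_y \sum_z ext A (27 * x * y * z) * (ext w y / ext w z) *
     ((x + y + z == 1)%:R * 'q_F - 1).
Proof.
move=> Al; have Awl := lin_mul Al w_lin; have wVl := lin_inv w_lin.
have AwVl := lin_mul Al wVl; have A3l := lin_exp 3 Al.
pose c (t : F * F * F) :=
  ext A (t.1.1 * t.1.2 * t.2) * (ext w t.1.2 / ext w t.2).
rewrite (@gauss_homog _ (A ^+ 3) (F * F * F)%type _ c
  (fun t => t.1.1 + t.1.2 + t.2)) //; last first.
  move=> v v0; rewrite /prod3 (gauss_scale Al v0) (gauss_scale Awl v0).
  rewrite (gauss_scale AwVl v0) ext_exp ?oppr_eq0 // !ext_mull ext_inv //.
  rewrite sum_triple /=; set X := \sum_x _; set Y := \sum_x _; set Z := \sum_x _.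
  have wv0 : ext w (- v) != 0 by rewrite ext_neq0 ?oppr_eq0.
  transitivity (ext A (- v) ^+ 3 * (X * (Y * Z))); first by field.
  congr (_ * _); rewrite /X mulr_suml; apply: eq_bigr => x _.
  rewrite /Y mulr_suml mulr_sumr; apply: eq_bigr => y _.
  rewrite /Z !mulr_sumr; apply: eq_bigr => z _.
  rewrite /c /= !extM // !ext_mull ext_inv // !mulrDr !additive_charD.
  by ring.
have N1 : (-1 : F) != 0 by rewrite oppr_eq0 oner_eq0.
rewrite -(mulN1r 27) extM // ext_exp // mulrACA mulrA.
have -> : ext A (- 1) * ext A (- 1) ^+ 3 = 1.
  by rewrite !exprS expr0 mulr1 mulrA ext_sqrN1 // mul1r.
rewrite mul1r sum_triple /= mulr_sumr; apply: eq_bigr => x _.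
rewrite mulr_sumr; apply: eq_bigr => y _.
rewrite mulr_sumr; apply: eq_bigr => z _.
by rewrite /c /= !extM //; ring.
Qed.

(** Orthogonality imposes [27 * x * y * z = 1]. The indicator of [x + y + z = 1] then gives the
    nodal cubic, while the constant [-1] contributes nothing because [w] sums to 0. *)
Lemma sum_prod3 :
  \sum_(i : Iirr [set: {unit F}])
     ext 'chi_i (- 27) * (prod3 'chi_i * gauss ('chi_i ^+ 3)^-1) =
  ('q_F - 1) * 'q_F * ('q_F - 1 - \sum_(s : F) (s ^+ 2 + s + 1 == 0)%:R).
Proof.
have F27 : (27 : F) != 0.
  by have -> : (27 : F) = 3 ^+ 3 by [ring]; rewrite expf_neq0.
under eq_bigr do rewrite prod3_expand ?irr_unit_lin //.
rewrite exchange_big /=.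
transitivity (('q_F - 1) * \sum_(x : F) \sum_y \sum_z
   (27 * x * y * z == 1)%:R * (ext w y / ext w z) *
     ((x + y + z == 1)%:R * 'q_F - 1)).
  rewrite mulr_sumr; apply: eq_bigr => x _.
  rewrite exchange_big /= mulr_sumr; apply: eq_bigr => y _.
  rewrite exchange_big /= mulr_sumr; apply: eq_bigr => z _.
  by rewrite -!mulr_suml sum_irr; ring.
rewrite -mulrA; congr (_ * _); rewrite -(nodal_cubic_sum w_lin w_cube F3).
(* Either condition determines [x] from [y] and [z], so [sum_delta] removes the sum over [x] from
   both terms. *)
transitivity (\sum_(y : F) \sum_z \sum_x
  ((x == 1 - y - z)%:R * ('q_F * ((27 * x * y * z == 1)%:R * (ext w y / ext w z)))
   - (x == (27 * y * z)^-1)%:R * (ext w y / ext w z))).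
  rewrite exchange_big /=; apply: eq_bigr => y _.
  rewrite exchange_big /=; apply: eq_bigr => z _; apply: eq_bigr => x _.
  have -> : (x == 1 - y - z) = (x + y + z == 1).
    by rewrite -[x == _]subr_eq0 -[RHS]subr_eq0; congr (_ == 0); ring.
  have [->|y0] := eqVneq y 0; first by rewrite ext0; ring.
  have [->|z0] := eqVneq z 0; first by rewrite ext0 invr0; ring.
  have -> : (x == (27 * y * z)^-1) = (27 * x * y * z == 1).
    have yz0 : 27 * y * z != 0 by rewrite !mulf_neq0.
    rewrite -(inj_eq (mulfI yz0)) divff //; congr (_ == _); ring.
  by ring.
have S0 : \sum_(y : F) \sum_(z : F) ext w y / ext w z = 0.
  under eq_bigr do rewrite -mulr_sumr.
  by rewrite -mulr_suml sum_ext // (negPf w_neq1) !mul0r.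
rewrite -[RHS]subr0 -[X in _ = _ - X]S0 mulr_sumr -sumrB; apply: eq_bigr => y _.
rewrite mulr_sumr -sumrB; apply: eq_bigr => z _.
by rewrite sumrB !sum_delta.
Qed.

(** Each of the four Gauss sums has norm at most the square root of ['q_F]. If [A ^+ 3 = 1], two of
    them belong to the trivial character and have norm 1, which lowers the bound from the square of
    ['q_F] to ['q_F]. *)
Lemma norm_prod3_le (A : mchar F) : A \is a linear_char ->
  `|ext A (- 27) * (prod3 A * gauss (A ^+ 3)^-1)| <=
  'q_F * ('q_F - (A ^+ 3 == 1)%:R * ('q_F - 1)).
Proof.
move=> Al; have Awl := lin_mul Al w_lin; have wVl := lin_inv w_lin.
have AwVl := lin_mul Al wVl; have A3l := lin_exp 3 Al.
have A3Vl := lin_inv A3l.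
have F27 : (-27 : F) != 0.
  by have -> : (-27 : F) = - 3 ^+ 3 by [ring]; rewrite oppr_eq0 expf_neq0.
rewrite !normrM norm_ext // mul1r.
have q_ge1 : 1 <= 'q_F.
  by rewrite ler1n; apply/card_gt0P; exists 0.
have q_ge0 : 0 <= 'q_F := le_trans ler01 q_ge1.
pose r := sqrtC 'q_F.
have r_ge1 : 1 <= r by rewrite -sqrtC1 /r ler_sqrtC ?ler01 // qualifE /=.
have r_ge0 : 0 <= r := le_trans ler01 r_ge1.
have rr : r * r = 'q_F by rewrite -expr2 sqrtCK.
have norm1 (B : mchar F) : B \is a linear_char -> B = 1 -> `|gauss B| = 1.
  move=> Bl B1; apply/eqP; rewrite -(eqrXn2 (ltn0Sn 1)) ?ler01 ?normr_ge0 //.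
  by rewrite normsq_gauss // B1 eqxx expr1n.
have norm_r (B : mchar F) : B \is a linear_char -> B != 1 -> `|gauss B| = r.
  move=> Bl /negPf B1; apply/eqP.
  by rewrite -(eqrXn2 (ltn0Sn 1)) ?normr_ge0 // normsq_gauss // B1 -rr expr2.
have norm_le (B : mchar F) : B \is a linear_char -> `|gauss B| <= r.
  move=> Bl; have [B1|B1] := eqVneq B 1; first by rewrite norm1.
  by rewrite norm_r.
have [A3|A3] := eqVneq (A ^+ 3) 1.
  rewrite mul1r opprB addrC subrK mulr1 -rr.
  rewrite [`|gauss (A ^+ 3)^-1|]norm1 // ?A3 ?invr1 // mulr1.
  case: (cube_eq1 Al A3) => [E|E|E].
  - rewrite (norm1 _ Al E) mul1r; apply: ler_pM => //; exact: norm_le.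
  - rewrite (norm1 _ Awl E) mulr1; apply: ler_pM => //; exact: norm_le.
  - rewrite (norm1 _ AwVl E) mulr1; apply: ler_pM => //; exact: norm_le.
rewrite mul0r subr0 -rr [X in X <= _](_ : _ = `|gauss A| * `|gauss (A * w)| *
  (`|gauss (A * w^-1)| * `|gauss (A ^+ 3)^-1|)); last by ring.
by do ![apply: ler_pM; rewrite ?mulr_ge0 ?normr_ge0 ?norm_le //].
Qed.

(** The Hasse-Davenport formula for 3. Equality of the sums in [sumE] forces each number to equal
    its bound, and [gauss_inv] for [A ^+ 3] then cancels [gauss (A ^+ 3)^-1]. *)
Lemma gauss_triplication (A : mchar F) : A \is a linear_char ->
  ext A 27 * prod3 A = 'q_F * gauss (A ^+ 3).
Proof.
move=> Al; have A3l := lin_exp 3 Al; have A3Vl := lin_inv A3l.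
have N1 : (-1 : F) != 0 by rewrite oppr_eq0 oner_eq0.
have [i Ai] := lin_irr_ex Al.
have sumE : \sum_(i : Iirr [set: {unit F}])
     ext 'chi_i (- 27) * (prod3 'chi_i * gauss ('chi_i ^+ 3)^-1) =
   \sum_(i : Iirr [set: {unit F}])
     'q_F * ('q_F - ('chi_i ^+ 3 == 1)%:R * ('q_F - 1)).
  rewrite sum_prod3 -mulr_sumr sumrB.
  (* The number of characters, ['q_F - 1], is read off from [sum_irr] at 1. *)
  have -> : \sum_(i : Iirr [set: {unit F}]) 'q_F = 'q_F * ('q_F - 1).
    rewrite -[X in _ = _ * X]mul1r -[X in _ * (X * _)](_ : (1 == 1 :> F)%:R = _).
      rewrite -sum_irr mulr_sumr; apply: eq_bigr => j _.
      by rewrite ext1 ?mulr1 ?irr_unit_lin.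
    by rewrite eqxx.
  (* Summing ['chi_i ^+ 3] at [x], that is ['chi_i] at [x ^+ 3], in both orders shows that there are
     as many characters of trivial cube as cube roots of 1. *)
  have -> : \sum_(i : Iirr [set: {unit F}]) ('chi_i ^+ 3 == 1)%:R * ('q_F - 1)
      = ('q_F - 1) * (1 + \sum_(x : F) (x ^+ 2 + x + 1 == 0)%:R).
    rewrite -card_cube_roots1 //.
    under eq_bigr do rewrite -sum_ext ?lin_exp ?irr_unit_lin //.
    rewrite exchange_big mulr_sumr /=; apply: eq_bigr => x _.
    rewrite mulrC -sum_irr; apply: eq_bigr => j _.
    have [->|x0] := eqVneq x 0; first by rewrite expr0n !ext0.
    by rewrite ext_exp // extX ?irr_unit_lin.
  by ring.
(* The bounds of [norm_prod3_le] have the same sum as the numbers they bound. *)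
have := normC_sum_upper (fun j _ => norm_prod3_le (irr_unit_lin j)) sumE.
move=> /(_ i isT); rewrite -Ai => TE.
apply: (mulIf (gauss_neq0 A3Vl)).
rewrite -[in RHS]mulrA gauss_inv // [RHS]mulrCA -TE -(mulN1r 27) extM // ext_exp //.
have aa := ext_sqrN1 Al; set a := ext A (- 1) in aa *.
transitivity ((a * a) * (a * a) * (ext A 27 * prod3 A * gauss (A ^+ 3)^-1)).
  by rewrite aa !mul1r.
by ring.
Qed.

End Triplication.

(** * The duplication formula *)

Section Quadratic.

Variables (F : finFieldType) (phi : mchar F).
Hypotheses (phi_lin : phi \is a linear_char) (phi_neq1 : phi != 1).
Hypotheses (phi_sqr : phi ^+ 2 = 1) (F2 : (2 : F) != 0).

Lemma ext_quad_sqr (x : F) : x != 0 -> ext phi x ^+ 2 = 1.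
Proof. by move=> x0; rewrite -ext_exp // phi_sqr ext1x x0. Qed.

Lemma card_sqrt (v : F) : \sum_y (y ^+ 2 == v)%:R = 1 + ext phi v.
Proof.
(* [1 + phi u] is at least the number of square roots of [u], and the sums over
   [u] agree, because [phi] sums to 0. *)
have le_sqrt (u : F) : true -> 0 <= 1 + ext phi u - \sum_y (y ^+ 2 == u)%:R.
  move=> _; have [->|u0] := eqVneq u 0.
    rewrite ext0 addr0 [X in _ - X](_ : _ = 1) ?subrr //.
    rewrite -[RHS](sum_delta (0 : F) (fun=> 1)); apply: eq_bigr => y _.
    by rewrite mulr1 expf_eq0.
  have [y0 /eqP y0u|nsq] := pickP [pred y : F | y ^+ 2 == u].
    have y0n : y0 != 0 by apply: contraNneq u0 => y00; rewrite -y0u y00 expr0n.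
    rewrite -y0u extX // ext_quad_sqr //.
    rewrite [X in _ - X](_ : _ = 1 + 1) ?subrr //.
    rewrite -[X in _ = X + _](sum_delta y0 (fun=> 1)).
    rewrite -[X in _ = _ + X](sum_delta (- y0) (fun=> 1)) -big_split /=.
    apply: eq_bigr => y _; rewrite !mulr1 eqf_sqr.
    have [->|_] := eqVneq y y0; last by rewrite add0r.
    have -> : (y0 == - y0) = false; last by rewrite addr0.
    apply/negbTE; rewrite -addr_eq0 (_ : y0 + y0 = 2 * y0); last by ring.
    by rewrite mulf_neq0.
  rewrite big1 => [|y _]; last by rewrite (nsq y : (_ == u) = false).
  have /eqP := ext_quad_sqr u0; rewrite subr0 sqrf_eq1 => /orP[]/eqP->.
    by rewrite addr_ge0 ?ler01.
  by rewrite subrr.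
have sum0 : \sum_(u : F) (1 + ext phi u - \sum_y (y ^+ 2 == u)%:R) = 0.
  rewrite sumrB big_split /= sum_ext // (negPf phi_neq1) mul0r addr0.
  rewrite exchange_big -sumrB big1 //= => y _.
  under eq_bigr do rewrite eq_sym -[_%:R]mulr1.
  by rewrite (sum_delta _ (fun=> 1)) subrr.
have /eqP := psumr_eq0P le_sqrt sum0 (isT : xpredT v).
by rewrite subr_eq0 => /eqP.
Qed.

Lemma sum_over_sqr (f : F -> algC) :
  \sum_y f (y ^+ 2) = \sum_v f v * (1 + ext phi v).
Proof.
under [RHS]eq_bigr do rewrite -card_sqrt mulr_sumr.
rewrite exchange_big /=; apply: eq_bigr => y _.
under eq_bigr do rewrite mulrC eq_sym.
by rewrite sum_delta.
Qed.

(** The substitution [x = (1 + y) / 2] turns [4 * x * (1 - x)] into [1 - y ^+ 2]. In [sum_over_sqr]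
    the term without [phi] is the complete sum of [A], hence 0. *)
Lemma jacobi_dup (A : mchar F) : A \is a linear_char -> A != 1 ->
  ext A 4 * jacobi A A = jacobi A phi.
Proof.
move=> Al A1; have F4 : (4 : F) != 0.
  by have -> : (4 : F) = 2 * 2 by [ring]; rewrite mulf_neq0.
transitivity (\sum_y ext A (1 - y ^+ 2)).
  rewrite /jacobi mulr_sumr.
  have inj_h : injective (fun y : F => (1 + y) / 2).
    by move=> y z /(mulIf (invr_neq0 F2))/addrI.
  rewrite (reindex_inj inj_h) /=; apply: eq_bigr => y _.
  by rewrite -!extM //; congr (ext A _); field.
rewrite (sum_over_sqr (fun v => ext A (1 - v))).
under eq_bigr do rewrite mulrDr mulr1.
rewrite big_split /= (reindex_inj (inv_inj (@subKr _ (1 : F)))) /=.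
under eq_bigr do rewrite subKr.
rewrite sum_ext // (negPf A1) mul0r add0r /jacobi.
rewrite (reindex_inj (inv_inj (@subKr _ (1 : F)))) /=.
by apply: eq_bigr => v _; rewrite subKr.
Qed.

Lemma phiV : phi^-1 = phi.
Proof.
apply: (mulrI (lin_char_unitr phi_lin)).
by rewrite divrr ?lin_char_unitr // -expr2.
Qed.

Lemma gauss_quad : gauss phi * gauss phi = ext phi (- 1) * 'q_F.
Proof.
by rewrite -{2}phiV gauss_inv // (negPf phi_neq1) mul0r subr0.
Qed.

(** The Hasse-Davenport formula for 2: both sides of [jacobi_dup] are rewritten in Gauss sums. *)
Lemma gauss_duplication (A : mchar F) : A \is a linear_char ->
  ext A 4 * (gauss A * gauss (A * phi)) = gauss (A * A) * gauss phi.
Proof.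
move=> Al; have Aphil := lin_mul Al phi_lin.
have F4 : (4 : F) != 0.
  by have -> : (4 : F) = 2 * 2 by [ring]; rewrite mulf_neq0.
have [->|A1] := eqVneq A 1; first by rewrite !mul1r ext1x F4 mul1r.
have AVl := lin_inv Al; have AU := lin_char_unitr Al.
have AV1 : A^-1 != 1 by apply: contraNneq A1 => AV; rewrite -[A]invrK AV invr1.
(* With [A^-1] in place of [A], the third Gauss sums of [gauss_jacobi] are those of [A * A] and
   [A * phi]. *)
have jA := gauss_jacobi AVl AVl.
rewrite AV1 in jA; have {jA} jA := jA isT.
have jp := gauss_jacobi AVl phi_lin; rewrite AV1 in jp; have {jp} jp := jp isT.
rewrite -jacobi_dup // in jp.
rewrite -invrM // invrK ext_sqrN1 // mul1r in jA.
have AphiV : (A^-1 * phi)^-1 = A * phi.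
  by rewrite invrM ?unitrV ?lin_char_unitr // invrK phiV mulrC.
rewrite AphiV !ext_inv // in jp.
have gA := gauss_inv Al; rewrite (negPf A1) mul0r subr0 in gA.
have gAV := gauss_neq0 AVl; have gp := gauss_neq0 phi_lin.
have a4 := ext_neq0 Al F4.
have N0 : (-1 : F) != 0 by rewrite oppr_eq0 oner_eq0.
have aN := ext_neq0 Al N0; have pN := ext_neq0 phi_lin N0.
have pp := ext_sqrN1 phi_lin; have aa := ext_sqrN1 Al.
have gq := gauss_quad; have q0 := qF_neq0 F.
apply: (mulIf (mulf_neq0 (mulf_neq0 gAV pN) q0)).
set a := ext A (- 1) in jp gA aN *; set p := ext phi (- 1) in jp gq pN *.
transitivity (ext A 4 * gauss A * gauss A^-1 * gauss (A * phi) * (p * 'q_F)).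
  by ring.
rewrite -gq; transitivity (ext A 4 * gauss A * gauss phi *
   (gauss A^-1 * gauss phi * gauss (A * phi))); first by ring.
rewrite jp; transitivity (gauss A * gauss phi * (a^-1 * p) *
   ('q_F * jacobi A^-1 A^-1)); first by field; rewrite a4 aN.
rewrite -jA; transitivity (gauss A * gauss A^-1 * gauss phi * (a^-1 * p) *
   (gauss A^-1 * gauss (A * A))); first by ring.
by rewrite gA; field.
Qed.

End Quadratic.

(** * The coefficients of the hypergeometric series *)

Lemma gauss1 (F : finFieldType) : gauss (1 : mchar F) = -1.
Proof.
transitivity (\sum_(x : F) (additive_char (1 * x) - (x == 0)%:R * additive_char x)).
  apply: eq_bigr => x _; rewrite mul1r ext1x.
  by case: eqP => _ /=; ring.
by rewrite sumrB sum_additive_char oner_eq0 mul0r sum_delta additive_char0 sub0r.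
Qed.

(** The pair of characters that [gauss_jacobi] excludes; it occurs in the coefficient at [phi]. *)
Lemma jacobi11 (F : finFieldType) : jacobi (1 : mchar F) 1 = 'q_F - 2.
Proof.
transitivity (\sum_(x : F) ((1 : algC) - (x == 0)%:R * 1 - (x == 1)%:R * 1)).
  apply: eq_bigr => x _; rewrite !ext1x subr_eq0 (eq_sym 1 x).
  have [->|x0] := eqVneq x 0; first by rewrite eq_sym oner_eq0 /=; ring.
  by case: eqP => _ /=; ring.
by rewrite !sumrB !sum_delta sumr_const; ring.
Qed.

Section Sextic.

(** The upper parameters of the series will be [phi * w^-1] and [phi * w], with [phi] quadratic and
    [w] cubic. *)
Variables (F : finFieldType) (phi w : mchar F).
Hypotheses (phi_lin : phi \is a linear_char) (phi_neq1 : phi != 1).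
Hypothesis phi_sqr : phi ^+ 2 = 1.
Hypotheses (w_lin : w \is a linear_char) (w_neq1 : w != 1).
Hypothesis w_cube : w ^+ 3 = 1.
Hypothesis cube_eq1 : forall A : mchar F, A \is a linear_char -> A ^+ 3 = 1 ->
  [\/ A = 1, A * w = 1 | A * w^-1 = 1].
Hypotheses (F2 : (2 : F) != 0) (F3 : (3 : F) != 0).

Let N0 : (-1 : F) != 0. Proof. by rewrite oppr_eq0 oner_eq0. Qed.

Let F4 : (4 : F) != 0.
Proof. by have -> : (4 : F) = 2 * 2 by [ring]; rewrite mulf_neq0. Qed.

Let F27 : (27 : F) != 0.
Proof. by have -> : (27 : F) = 3 ^+ 3 by [ring]; rewrite expf_neq0. Qed.

Let phiVE : phi^-1 = phi := phiV phi_lin phi_sqr.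

Let wU : w \is a GRing.unit := lin_char_unitr w_lin.
Let phiU : phi \is a GRing.unit := lin_char_unitr phi_lin.

Lemma cubic_extN1 : ext w (- 1) = 1.
Proof.
have -> : -1 = (-1) ^+ 3 :> F by ring.
by rewrite extX // -ext_exp // w_cube ext1x N0.
Qed.

Lemma sextic_neq1 : phi * w^-1 != 1.
Proof.
apply: contraNneq phi_neq1 => E.
have pw : phi = w by rewrite -[LHS](mulrVK wU) E mul1r.
by apply/eqP; rewrite -[RHS]w_cube exprS -pw phi_sqr mulr1.
Qed.

(** For the two Jacobi sums, the third Gauss sums in [gauss_jacobi] belong to [phi * w] and
    [phi * w^-1]. These are mutually inverse, so [gauss_inv] evaluates their product. *)
Lemma jacobi_sextic (chi : mchar F) : chi \is a linear_char ->
  'q_F * 'q_F * (jacobi (phi * w^-1 * chi) chi^-1 * jacobi (phi * w * chi) chi^-1) =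
  ext phi (- 1) * 'q_F * (gauss (phi * chi * w) * gauss (phi * chi * w^-1)) *
  (gauss chi^-1 * gauss chi^-1).
Proof.
move=> Xl; have XVl := lin_inv Xl; have wVl := lin_inv w_lin.
have XU := lin_char_unitr Xl.
have l1 := lin_mul (lin_mul phi_lin wVl) Xl.
have l2 := lin_mul (lin_mul phi_lin w_lin) Xl.
have c1 : (phi * w^-1 * chi != 1) || (chi^-1 != 1).
  have [X1|//] := eqVneq chi^-1 1; last by rewrite orbT.
  by rewrite -[chi]invrK X1 invr1 mulr1 sextic_neq1.
have pwV : (phi * w)^-1 = phi * w^-1 by rewrite invrM // phiVE mulrC.
have pwVV : (phi * w^-1)^-1 = phi * w by rewrite -pwV invrK.
have c2 : (phi * w * chi != 1) || (chi^-1 != 1).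
  have [X1|//] := eqVneq chi^-1 1; last by rewrite orbT.
  rewrite -[chi]invrK X1 invr1 mulr1 -[phi * w]invrK pwV.
  by rewrite invr_eq1 sextic_neq1.
have j1 := gauss_jacobi l1 XVl c1; have j2 := gauss_jacobi l2 XVl c2.
rewrite mulrK // pwVV in j1; rewrite mulrK // pwV in j2.
have gg := gauss_inv (lin_mul phi_lin w_lin).
rewrite pwV ext_mull cubic_extN1 in gg.
have pw1 : (phi * w == 1) = false.
  apply/negbTE; apply: contraNneq sextic_neq1 => E.
  by rewrite -pwV E invr1.
rewrite pw1 mul0r subr0 mulr1 in gg.
rewrite !ext_mull !ext_inv // cubic_extN1 in j1 j2.
have pp := ext_sqrN1 phi_lin.
have x0 := ext_neq0 Xl N0.
have E1 : phi * chi * w^-1 = phi * w^-1 * chi by rewrite mulrAC.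
have E2 : phi * chi * w = phi * w * chi by rewrite mulrAC.
rewrite E1 E2.
set J1 := jacobi _ _ in j1 *; set J2 := jacobi _ _ in j2 *.
set p := ext phi (- 1) in j1 j2 gg pp *; set x := ext chi _ in j1 j2 x0.
have k1 : 'q_F * J1 = p * (p * 1^-1 * x / x * 'q_F * J1).
  by transitivity (p * p * ('q_F * J1)); [rewrite pp mul1r | field].
have k2 : 'q_F * J2 = p * (p * 1 * x / x * 'q_F * J2).
  by transitivity (p * p * ('q_F * J2)); [rewrite pp mul1r | field].
rewrite mulrACA k1 k2 -j1 -j2; set g1 := gauss (_ * chi); set g2 := gauss (_ * chi).
transitivity (p * p * (g1 * g2) * (gauss (phi * w) * gauss (phi * w^-1)) *
   (gauss chi^-1 * gauss chi^-1)); first by ring.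
by rewrite gg pp; ring.
Qed.

(** The left side is the coefficient of the series up to a power of ['q_F], the right side that of
    the curve in [curve_expansion]. For [chi != phi] all Jacobi sums become Gauss sums, matched by
    duplication and triplication. *)
Lemma jacobi_coef (chi : mchar F) : chi \is a linear_char ->
  jacobi (phi * w^-1 * chi) chi^-1 * jacobi (phi * w * chi) chi^-1 =
  ext phi (- 1) * (ext chi 4 * ext phi 27 / ext chi 27 * jacobi chi^-1 phi
     * jacobi (chi^-1 * chi^-1) (phi * chi^-1)) +
  (chi == phi)%:R * (2 * ('q_F - 1)).
Proof.
move=> Xl; have XVl := lin_inv Xl; have XU := lin_char_unitr Xl.
have q0 := qF_neq0 F; have wVl := lin_inv w_lin.
apply: (mulfI (mulf_neq0 q0 q0)); rewrite jacobi_sextic //.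
have p27 : ext phi 27 * ext phi 27 = 1 by rewrite -expr2 ext_quad_sqr.
have pp := ext_sqrN1 phi_lin; have gq := gauss_quad phi_lin phi_neq1 phi_sqr.
have pN := ext_neq0 phi_lin N0.
(* At [chi = phi] the left side is ['q_F], but the product on the right contains [jacobi 1 1] and
   equals [- ('q_F - 2)]; hence the correction [2 * ('q_F - 1)]. *)
have [E|Xphi] := eqVneq chi phi.
  have phi2 : phi * phi = 1 by rewrite -expr2.
  rewrite E phiVE phi2 !mul1r jacobi11.
  have jp := gauss_jacobi phi_lin phi_lin; rewrite phi_neq1 in jp.
  have {jp} := jp isT; rewrite phi2 invr1 gauss1 pp mul1r gq => jp.
  have gw := gauss_inv w_lin; rewrite (negPf w_neq1) cubic_extN1 in gw.
  have p4 : ext phi 4 = 1.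
    have -> : (4 : F) = 2 ^+ 2 by ring.
    by rewrite extX // ext_quad_sqr.
  rewrite gw mul0r subr0 p4 !mul1r divff ?ext_neq0 //.
  have Jp : jacobi phi phi = - ext phi (- 1).
    by apply: (mulfI q0); rewrite -jp; ring.
  rewrite Jp; set p := ext phi (- 1) in pp *.
  transitivity ((p * p) * ('q_F * 'q_F * 'q_F)); first by ring.
  transitivity (- (p * p) * ('q_F * 'q_F) * ('q_F - 2) +
    'q_F * 'q_F * (2 * ('q_F - 1))); last by ring.
  by rewrite pp; ring.
rewrite mul0r addr0.
have px1 : phi * chi^-1 != 1.
  apply: contraNneq Xphi => E; rewrite -[chi]mul1r -E mulrVK //.
have pxV : (phi * chi)^-1 = phi * chi^-1 by rewrite invrM // phiVE mulrC.
have pxVV : (phi * chi^-1)^-1 = phi * chi by rewrite -pxV invrK.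
have pxl := lin_mul phi_lin Xl; have pxVl := lin_mul phi_lin XVl.
have c3 : (chi^-1 != 1) || (phi != 1) by rewrite phi_neq1 orbT.
have c4 : (chi^-1 * chi^-1 != 1) || (phi * chi^-1 != 1) by rewrite px1 orbT.
have j3 := gauss_jacobi XVl phi_lin c3.
have j4 := gauss_jacobi (lin_mul XVl XVl) pxVl c4.
have E3 : (chi^-1 * phi)^-1 = phi * chi by rewrite mulrC pxVV.
have E4 : (chi^-1 * chi^-1 * (phi * chi^-1))^-1 = (phi * chi) ^+ 3.
  rewrite !exprS expr0 mulr1 -[phi in RHS]phiVE.
  rewrite !invrM ?unitrM ?unitrV ?XU ?phiU // !invrK phiVE.
  have -> : phi * chi * (phi * chi * (phi * chi)) =
      phi ^+ 2 * (phi * chi * (chi * chi)) by ring.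
  by rewrite phi_sqr mul1r; ring.
rewrite E3 in j3; rewrite E4 in j4.
have gx := gauss_inv pxl; rewrite pxV in gx.
have px2 : (phi * chi == 1) = false.
  by apply/negbTE; rewrite -invr_eq1 pxV px1.
rewrite px2 mul0r subr0 ext_mull in gx.
(* Duplication at [chi^-1] and triplication at [phi * chi] produce the Gauss sums of
   [chi^-1 * chi^-1] and [(phi * chi) ^+ 3] that occur in [j4]. *)
have d2 := gauss_duplication phi_lin phi_neq1 phi_sqr F2 XVl.
have d3 := gauss_triplication w_lin w_neq1 w_cube cube_eq1 F3 pxl.
rewrite !ext_mull !ext_inv // in j3 j4 d2 d3.
rewrite [chi^-1 * phi]mulrC in d2.
have x0 := ext_neq0 Xl N0; have x4 := ext_neq0 Xl F4; have x27 := ext_neq0 Xl F27.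
have xx := ext_sqrN1 Xl.
set p := ext phi (- 1) in pp pN gx j3 j4 *; set x := ext chi (- 1) in x0 xx gx j3 j4.
have xV : x^-1 = x by apply: (mulfI x0); rewrite divff.
rewrite xV in j3 j4; apply: (mulfI q0).
have k3 : 'q_F * jacobi chi^-1 phi = (x * x) * (p * p) * ('q_F * jacobi chi^-1 phi).
  by rewrite xx pp !mul1r.
have k4 : 'q_F * jacobi (chi^-1 * chi^-1) (phi * chi^-1) =
    (x * x) * (x * x) * (p * p) * ('q_F * jacobi (chi^-1 * chi^-1) (phi * chi^-1)).
  by rewrite xx pp !mul1r.
set J3 := jacobi chi^-1 phi in j3 k3 *.
set J4 := jacobi (chi^-1 * chi^-1) _ in j4 k4 *.
transitivity (p * ext chi 4 * ext phi 27 / ext chi 27 * ('q_F * J3) *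
  ('q_F * J4) * 'q_F); last by field.
have -> : 'q_F * J3 = x * p * (gauss chi^-1 * gauss phi * gauss (phi * chi)).
  by rewrite k3 j3; ring.
have -> : 'q_F * J4 = x * p * (gauss (chi^-1 * chi^-1) * gauss (phi * chi^-1)
    * gauss ((phi * chi) ^+ 3)).
  by rewrite k4 j4; ring.
transitivity (p * ext chi 4 * ext phi 27 / ext chi 27 * (x * x) * (p * p) *
  gauss chi^-1 * (gauss (chi^-1 * chi^-1) * gauss phi) *
  (gauss (phi * chi) * gauss (phi * chi^-1)) * ('q_F * gauss ((phi * chi) ^+ 3)));
  last by ring.
rewrite xx pp gx -d2 -d3.
transitivity (p * (ext phi 27 * ext phi 27) *
  gauss chi^-1 * gauss chi^-1 * gauss (phi * chi^-1) *
  (p * x * 'q_F) * (gauss (phi * chi) *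
    gauss (phi * chi * w) * gauss (phi * chi * w^-1))); last first.
  by field; rewrite x4 x27.
rewrite p27; transitivity (p * (p * x * 'q_F) * (gauss chi^-1 * gauss chi^-1) *
   (gauss (phi * chi * w) * gauss (phi * chi * w^-1)) *
   (gauss (phi * chi) * gauss (phi * chi^-1))); last by ring.
rewrite gx; transitivity ((p * p) * (x * x) * ('q_F * (p * 'q_F *
   (gauss (phi * chi * w) * gauss (phi * chi * w^-1)) *
   (gauss chi^-1 * gauss chi^-1)))); first by rewrite xx pp !mul1r.
by ring.
Qed.

End Sextic.

(** * The trace of Frobenius *)

(** Once the Jacobi sums are expanded, orthogonality over the characters selects
    [y = 4 * l / (27 * x ^+ 2 * (1 - x))]. Then [27 * (1 - x) * (1 - y)] times the square [x ^+ 2]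
    is the cubic on the right. *)
Lemma curve_expansion (F : finFieldType) (phi : mchar F) (l : F) :
  phi \is a linear_char -> phi ^+ 2 = 1 ->
  (2 : F) != 0 -> (3 : F) != 0 -> l != 0 ->
  \sum_(i : Iirr [set: {unit F}]) (ext 'chi_i 4 * ext phi 27 / ext 'chi_i 27
     * jacobi ('chi_i)^-1 phi
     * jacobi (('chi_i)^-1 * ('chi_i)^-1) (phi * ('chi_i)^-1)) * ext 'chi_i l
  + 2 * ('q_F - 1) * ext phi (- l) =
  ('q_F - 1) * \sum_x ext phi (27 * x ^+ 2 * (1 - x) - 4 * l).
Proof.
move=> phi_lin phi_sqr F2 F3 l0.
have F4 : (4 : F) != 0.
  by have -> : (4 : F) = 2 * 2 by [ring]; rewrite mulf_neq0.
have F27 : (27 : F) != 0.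
  by have -> : (27 : F) = 3 ^+ 3 by [ring]; rewrite expf_neq0.
have termE (i : Iirr [set: {unit F}]) :
  (ext 'chi_i 4 * ext phi 27 / ext 'chi_i 27 * jacobi ('chi_i)^-1 phi
     * jacobi (('chi_i)^-1 * ('chi_i)^-1) (phi * ('chi_i)^-1)) * ext 'chi_i l =
  \sum_x \sum_y ext 'chi_i (4 * l / (27 * y * x ^+ 2 * (1 - x))) *
     (ext phi (27 * (1 - x)) * ext phi (1 - y)).
  have Xl := irr_unit_lin i; move: ('chi_i) Xl => chi Xl.
  transitivity (jacobi (chi^-1 * chi^-1) (phi * chi^-1) *
    (ext chi 4 * ext phi 27 / ext chi 27 * ext chi l * jacobi chi^-1 phi)).
    by ring.
  rewrite {1}/jacobi mulr_suml; apply: eq_bigr => x _.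
  rewrite /jacobi !mulr_sumr; apply: eq_bigr => y _.
  by rewrite !ext_mull !ext_inv // !extM // extV // !extM // !invfM; ring.
under eq_bigr do rewrite termE.
rewrite exchange_big /= mulr_sumr.
(* The expanded sums have no term at [x = 0] and [x = 1]. There the cubic takes the value
   [- (4 * l)], and 4 is a square, which accounts for the two extra terms [ext phi (- l)]. *)
transitivity (\sum_(x : F) (('q_F - 1) * (((x == 0) || (x == 1)) ==> false)%:R *
    ext phi (27 * x ^+ 2 * (1 - x) - 4 * l)
  + (x == 0)%:R * (('q_F - 1) * ext phi (- l))
  + (x == 1)%:R * (('q_F - 1) * ext phi (- l)))).
  rewrite !big_split /= !sum_delta -addrA; congr (_ + _); last by ring.
  apply: eq_bigr => x _; rewrite exchange_big /=.
  under eq_bigr do rewrite -mulr_suml sum_irr.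
  have [->|x0] := eqVneq x 0.
    rewrite mulr0 mul0r big1 // => y _.
    by rewrite expr0n mulr0 mul0r invr0 mulr0 eq_sym oner_eq0 !mul0r.
  have [->|x1] := eqVneq x 1.
    rewrite mulr0 mul0r big1 // => y _.
    by rewrite subrr mulr0 invr0 mulr0 eq_sym oner_eq0 !mul0r.
  have x1' : 1 - x != 0 by rewrite subr_eq0 eq_sym.
  pose y0 := 4 * l / (27 * x ^+ 2 * (1 - x)).
  have d0 : 27 * x ^+ 2 * (1 - x) != 0 by rewrite !mulf_neq0 ?expf_neq0.
  transitivity (\sum_y (y == y0)%:R * (('q_F - 1) *
     (ext phi (27 * (1 - x)) * ext phi (1 - y)))).
    apply: eq_bigr => y _; rewrite -mulrA; congr ((nat_of_bool _)%:R * _).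
    have [->|yn0] := eqVneq y 0.
      have -> : (0 == y0) = false.
        by apply/negbTE; rewrite eq_sym !mulf_neq0 ?invr_eq0.
      by rewrite mulr0 !mul0r invr0 mulr0 eq_sym oner_eq0.
    have dy : 27 * y * x ^+ 2 * (1 - x) != 0 by rewrite !mulf_neq0 ?expf_neq0.
    rewrite -(inj_eq (mulIf dy)) mul1r mulfVK // /y0.
    rewrite -[RHS](inj_eq (mulIf d0)) mulfVK // [RHS]eq_sym; congr (_ == _); ring.
  rewrite sum_delta mulr1; congr (_ * _).
  rewrite -extM // -[LHS]mul1r -(ext_quad_sqr phi_sqr x0) -extX // -extM //.
  by congr (ext phi _); rewrite /y0; field; rewrite x0 F27 x1'.
apply: eq_bigr => x _.
have p4 : ext phi (- (4 * l)) = ext phi (- l).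
  have -> : - (4 * l) = 2 ^+ 2 * - l by ring.
  by rewrite extM // extX // ext_quad_sqr // mul1r.
have [->|x0] := eqVneq x 0.
  have -> : 27 * 0 ^+ 2 * (1 - 0) - 4 * l = - (4 * l) by ring.
  by rewrite p4 eq_sym oner_eq0 /=; ring.
have [->|x1] := eqVneq x 1.
  have -> : 27 * 1 ^+ 2 * (1 - 1) - 4 * l = - (4 * l) by ring.
  by rewrite p4 /=; ring.
by rewrite /=; ring.
Qed.

Lemma natr_card (F : finFieldType) : #|F|%:R = 0 :> F.
Proof.
rewrite -FinRing.zmodXgE -cardsT; apply: expg_cardG.
by rewrite inE.
Qed.

Lemma mchar_exp_card (F : finFieldType) (A : mchar F) :
  A \is a linear_char -> A ^+ #|F|.-1 = 1.
Proof.
move=> Al; apply/cfunP => u; rewrite -card_finField_unit -ext_val ext_exp.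
  by rewrite ext_val -lin_charX ?inE // expg_cardG ?inE // lin_char1 // cfun1E inE.
by rewrite -unitfE (valP u).
Qed.

(** A nonzero remainder [r] of [n] would give [T ^+ r = 1], so the powers of [T] would provide at
    most [r] characters, fewer than the [#|F|.-1] irreducible ones. *)
Lemma generator_dvd (F : finFieldType) (T : mchar F) n :
  mchar_generator T -> T ^+ n = 1 -> (#|F|.-1 %| n)%N.
Proof.
move=> [T_lin T_gen] Tn.
have N0 : (0 < #|F|.-1)%N by rewrite -subn1 subn_gt0 finNzRing_gt1.
have TN := mchar_exp_card T_lin.
set r := (n %% #|F|.-1)%N.
have Tr : T ^+ r = 1.
  by move: Tn; rewrite {1}(divn_eq n #|F|.-1) exprD mulnC exprM TN expr1n mul1r.
rewrite /dvdn -/r; apply: contraT; rewrite -lt0n => r_gt0.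
have irr_sub : {subset irr [set: {unit F}] <= [seq T ^+ j | j <- iota 0 r]}.
  move=> chi /irrP[i ->]; have [m ->] := T_gen _ (irr_unit_lin i).
  apply/mapP; exists (m %% r)%N; first by rewrite mem_iota ltn_mod.
  by rewrite {1}(divn_eq m r) exprD mulnC exprM Tr expr1n mul1r.
have := uniq_leq_size (free_uniq (irr_free _)) irr_sub.
rewrite size_map size_iota size_tuple NirrE.
have := unit_abelian F; rewrite card_classes_abelian => /eqP->.
by rewrite card_finField_unit leqNgt ltn_mod N0.
Qed.

(** By [card_sqrt], [1 + phi] of the cubic counts the points above each [x]; the point at infinity
    cancels the 1 in the trace. *)
Lemma frobenius_trace_sum (F : finFieldType) (phi : mchar F) (a b : F) :
  phi \is a linear_char -> phi != 1 -> phi ^+ 2 = 1 -> (2 : F) != 0 ->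
  (frobenius_trace a b)%:~R =
  - \sum_x ext phi ((short_cubic a b).[x]) :> algC.
Proof.
move=> phi_lin phi_neq1 phi_sqr F2.
rewrite /frobenius_trace /num_points rmorphB rmorphD /= rmorph1 -addn1.
rewrite PoszD rmorphD /=.
have -> : (#|[set P : F * F | P.2 ^+ 2 == (short_cubic a b).[P.1]]|%:Z)%:~R =
   'q_F + \sum_x ext phi ((short_cubic a b).[x]).
  rewrite -pmulrn -sum1_card natr_sum big_mkcond /=.
  transitivity (\sum_x (1 + ext phi ((short_cubic a b).[x]))).
    under [RHS]eq_bigr do rewrite -(card_sqrt phi_lin phi_neq1 phi_sqr F2).
    rewrite pair_bigA /=; apply: eq_bigr => P _; rewrite inE.
    by case: ifP.
  by rewrite big_split /= sumr_const.
by rewrite -pmulrn; ring.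
Qed.

Lemma mchar_binom_jacobi (F : finFieldType) (A B : mchar F) :
  mchar_binom A B = ext B (- 1) / 'q_F * jacobi A B^-1.
Proof. by []. Qed.

Theorem theorem1p1 (p e q : nat) (F : finFieldType)
    (p_prime : prime p) (q_def : q = (p ^ e)%N) (card_F : #|F| = q)
    (q_mod6 : q = 1 %[mod 6])
    (a b : F) (E_elliptic : is_elliptic_curve a b)
    (a_neq0 : a != 0)
    (a3_square : exists s : F, s != 0 /\ s ^+ 2 = - a / 3)
    (T : mchar F) (T_gen : mchar_generator T)
    (k : F) (k_root : 3 * k ^+ 2 + a = 0) :
  (frobenius_trace a b)%:~R =
    - q%:R * mchar_ext (T ^+ ((q - 1) %/ 2)%N) (- k)
    * greene_2F1 (T ^+ ((q - 1) %/ 6)%N) (T ^+ ((5 * (q - 1)) %/ 6)%N) 1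
        (- (k ^+ 3 + a * k + b) / (4 * k ^+ 3)).
Proof.
pose m := ((q - 1) %/ 6)%N.
have q_gt1 : (1 < q)%N by rewrite -card_F finNzRing_gt1.
have qE : q = (6 * m + 1)%N.
  have := divn_eq q 6; rewrite q_mod6 modn_small // => qd.
  rewrite /m {2}qd addnK mulnK // mulnC; exact: qd.
have m_gt0 : (0 < m)%N.
  by rewrite lt0n; apply: contraTneq q_gt1 => m0; rewrite qE m0.
have -> : ((q - 1) %/ 2 = 3 * m)%N by rewrite qE addnK -(mulnA 2%N 3%N) mulKn.
have -> : (5 * (q - 1) %/ 6 = 5 * m)%N by rewrite qE addnK mulnCA mulKn.
rewrite -/m.
have [T_lin T_ex] := T_gen.
have F6m : (6 * m + 1)%:R = 0 :> F by rewrite -qE -card_F natr_card.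
(* In characteristic 2 or 3, [6 * m + 1 = 0] would read [1 = 0]. *)
have F2 : (2 : F) != 0.
  apply/eqP => F2; have /eqP := F6m; rewrite -[6%N]/(2 * 3)%N.
  by rewrite natrD !natrM F2 !mul0r add0r oner_eq0.
have F3 : (3 : F) != 0.
  apply/eqP => F3; have /eqP := F6m; rewrite -[6%N]/(2 * 3)%N.
  by rewrite natrD !natrM F3 mulr0 !mul0r add0r oner_eq0.
have Tdvd n : T ^+ n = 1 -> (6 * m %| n)%N.
  by move=> /(generator_dvd T_gen); rewrite card_F qE addn1.
have T6 : T ^+ (6 * m) = 1.
  by rewrite -(mchar_exp_card T_lin) card_F qE addn1.
pose phi := T ^+ (3 * m); pose w := T ^+ (2 * m).
have phi_lin : phi \is a linear_char by apply: lin_exp.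
have w_lin : w \is a linear_char by apply: lin_exp.
have wU := lin_char_unitr w_lin.
have phi_sqr : phi ^+ 2 = 1 by rewrite -exprM mulnAC.
have w_cube : w ^+ 3 = 1 by rewrite -exprM mulnAC.
have phi_neq1 : phi != 1.
  by apply/eqP => /Tdvd; rewrite dvdn_pmul2r.
have w_neq1 : w != 1.
  by apply/eqP => /Tdvd; rewrite dvdn_pmul2r.
have A0 : T ^+ m = phi * w^-1.
  by apply: (mulIr wU); rewrite mulrVK // -exprD -mulSn.
have A1 : T ^+ (5 * m) = phi * w by rewrite -exprD -mulnDl.
(* A trivial cube makes the exponent of [T] a multiple of [2 * m], so that [A] is 1, [w] or
   [w ^+ 2]. *)
have cube_eq1 (A : mchar F) : A \is a linear_char -> A ^+ 3 = 1 ->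
    [\/ A = 1, A * w = 1 | A * w^-1 = 1].
  move=> /T_ex[n ->]; rewrite -exprM => /Tdvd.
  have -> : (6 * m = 3 * (2 * m))%N by rewrite mulnA.
  rewrite (mulnC n) dvdn_pmul2l // => /dvdnP[j ->]; rewrite (mulnC j) exprM -/w.
  have -> : w ^+ j = w ^+ (j %% 3).
    by rewrite {1}(divn_eq j 3) exprD mulnC exprM w_cube expr1n mul1r.
  have : (j %% 3 < 3)%N by rewrite ltn_mod.
  case: (j %% 3)%N => [|[|[|]]] // _.
  - by apply: Or31.
  - by apply: Or33; rewrite expr1 divrr.
  - by apply: Or32; rewrite -exprSr.
rewrite A0 A1 -/phi.
have k0 : k != 0.
  apply: contraNneq a_neq0 => k0; move: k_root; rewrite k0 expr0n mulr0 add0r.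
  by move->.
have cubicE x : (short_cubic a b).[x] = x ^+ 3 + a * x + b.
  by rewrite /short_cubic !hornerE.
set c := k ^+ 3 + a * k + b.
(* If [c = 0], the point [(k, 0)] of the curve is singular, since the derivative of the cubic at [k]
   is [3 * k ^+ 2 + a = 0]. *)
have c0 : c != 0.
  apply/eqP => c0; apply: (E_elliptic F idfun k 0) => /=.
    by rewrite cubicE expr0n.
  rewrite mulr0; split=> //; rewrite /short_cubic !derivE !hornerE /=.
  by rewrite -k_root; ring.
set l := - c / (4 * k ^+ 3).
have F4 : (4 : F) != 0.
  by have -> : (4 : F) = 2 * 2 by [ring]; rewrite mulf_neq0.
have l0 : l != 0.
  apply: mulf_neq0; first by rewrite oppr_eq0.
  by rewrite invr_eq0 mulf_neq0 // expf_neq0.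
have q0 := qF_neq0 F.
have q1 : 'q_F - 1 != 0.
  by rewrite subr_eq0 (eqr_nat algC #|F| 1) card_F gtn_eqF.
have pp := ext_sqrN1 phi_lin.
rewrite (frobenius_trace_sum a b phi_lin phi_neq1 phi_sqr F2).
have sumE : \sum_x ext phi ((short_cubic a b).[x]) =
   ext phi k * \sum_x ext phi (27 * x ^+ 2 * (1 - x) - 4 * l).
  (* The cubic minus its value [c] at [k] has the double root [k] and the simple root [-2 * k]; this
     substitution moves them to 0 and 1. *)
  have inj_h : injective (fun x : F => k - 3 * k * x).
    by move=> x y /(addrI k)/oppr_inj/(mulfI (mulf_neq0 F3 k0)).
  rewrite (reindex_inj inj_h) /= mulr_sumr; apply: eq_bigr => x _.
  have -> : ext phi k = ext phi (k ^+ 3).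
    by rewrite extX // exprS ext_quad_sqr // mulr1.
  rewrite -extM // cubicE; congr (ext phi _).
  have aE : a = - (3 * k ^+ 2) by apply/eqP; rewrite -addr_eq0 addrC k_root.
  by rewrite /l /c aE; field; rewrite k0 F4.
rewrite sumE /greene_2F1.
have -> : \sum_(i | 'chi_i \is a linear_char)
    mchar_binom (phi * w^-1 * 'chi_i) 'chi_i *
    mchar_binom (phi * w * 'chi_i) (1 * 'chi_i) * ext 'chi_i l =
  ('q_F * 'q_F)^-1 * (ext phi (- 1) *
     (('q_F - 1) * \sum_x ext phi (27 * x ^+ 2 * (1 - x) - 4 * l))).
  rewrite -(curve_expansion phi_lin phi_sqr F2 F3 l0).
  have [ip ipE] := lin_irr_ex phi_lin.
  (* Spreading the extra term over all characters, supported at the index of [phi], allows a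
     termwise comparison with [jacobi_coef]. *)
  have -> : 2 * ('q_F - 1) * ext phi (- l) = \sum_(i : Iirr [set: {unit F}])
      (i == ip)%:R * (2 * ('q_F - 1) * (ext 'chi_i (- 1) * ext 'chi_i l)).
    by rewrite sum_delta -ipE -extM // mulN1r.
  rewrite -big_split /= !mulr_sumr; apply: eq_big => [i|i _].
    by rewrite irr_unit_lin.
  have Xl := irr_unit_lin i; have xx := ext_sqrN1 Xl.
  rewrite !mchar_binom_jacobi mul1r.
  transitivity (('q_F * 'q_F)^-1 * ((ext 'chi_i (- 1) * ext 'chi_i (- 1)) *
     (jacobi (phi * w^-1 * 'chi_i) ('chi_i)^-1 *
      jacobi (phi * w * 'chi_i) ('chi_i)^-1) * ext 'chi_i l)); first by field.
  rewrite xx mul1r; congr (_ * _).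
  rewrite (jacobi_coef phi_lin phi_neq1 phi_sqr w_lin w_neq1 w_cube cube_eq1)
    //.
  have -> : ('chi_i == phi) = (i == ip) by rewrite ipE (inj_eq irr_inj).
  have [->|_] := eqVneq i ip; last by rewrite /=; ring.
  rewrite -ipE; set p0 := ext phi (- 1) in pp *.
  rewrite mulrDl [RHS]mulrDr; congr (_ + _); first by ring.
  by transitivity ((p0 * p0) * (2 * ('q_F - 1) * ext phi l));
    [rewrite pp|]; rewrite /=; ring.
rewrite -card_F -(mulN1r k) extM //.
set S := \sum_x _; set p0 := ext phi (- 1) in pp *.
transitivity (- (p0 * p0 * (ext phi k * S))); first by rewrite pp mul1r.
by field; rewrite q0 q1.
Qed.
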